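(* Let $n$ be a positive integer and let $\chi$ be a Dirichlet character modulo $n$ whose conductor is $d$. Let $k$ be a non-negative integer. Then $$\sum_{\substack{a\in\mathbb{Z}_n^\ast \\ b_1,\ldots,b_k\in\mathbb{Z}_n}} \gcd(a-1,b_1,\ldots,b_k,n)\,\chi(a)=\varphi(n)\,\sigma_k\!\left(\frac{n}{d}\right).$$
   Context: $\mathbb{Z}_n=\mathbb{Z}/n\mathbb{Z}$ and $\mathbb{Z}_n^\ast$ is its group of units. A Dirichlet character modulo $n$ is viewed as a group homomorphism $\chi:\mathbb{Z}_n^\ast\to\mathbb{C}^\ast$; its conductor $d$ is the smallest positive divisor of $n$ such that $\chi$ factors through the reduction map $\mathbb{Z}_n^\ast\to\mathbb{Z}_d^\ast$. $\varphi$ is Euler's totient function and $\sigma_k(m)=\sum_{e\mid m}e^k$ (sum over positive divisors $e$ of $m$). The gcd is computed using any integer representatives of the residue classes; since $n$ is among its arguments, it does not depend on the choice. When $k=0$ there are no variables $b_i$, and the sum is $\sum_{a\in\mathbb{Z}_n^\ast}\gcd(a-1,n)\chi(a)$. *)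

(* Defs.v *)
From HB Require Import structures.
From mathcomp Require Import all_boot all_order all_algebra all_fingroup.
From mathcomp Require Import reals.
From mathcomp.real_closed Require Import complex.

Set Implicit Arguments.
Unset Strict Implicit.
Unset Printing Implicit Defensive.

Import GRing.Theory.
Local Open Scope ring_scope.

(* The type 'Z_1 is the ring Z/2Z, but its unit group {unit 'Z_1} is trivial,
   as is (Z/1Z)^*, and [Zp 1] is the singleton {0}.  Hence {unit 'Z_n} and
   [Zp n] are the unit group and the residues modulo n for every n > 0. *)

(* When 1 < d and d divides n, the class of a modulo d is a unit and the
   default value is not used.  When d = 1 the result is 1, the only element
   of {unit 'Z_1}. *)
Definition reduction (n d : nat) (a : {unit 'Z_n}) : {unit 'Z_d} :=
  insubd (1%g : {unit 'Z_d}) ((val a : nat)%:R : 'Z_d).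

Definition dirichlet_character (R : realType) (n : nat)
    (chi : {unit 'Z_n} -> R[i]) : Prop :=
  (forall a, chi a != 0) /\ (forall a b, chi (a * b)%g = chi a * chi b).

Definition factors_modulo (R : realType) (n d : nat)
    (chi : {unit 'Z_n} -> R[i]) : Prop :=
  exists psi : {unit 'Z_d} -> R[i],
    dirichlet_character psi /\ forall a, chi a = psi (reduction d a).

Definition is_conductor (R : realType) (n d : nat)
    (chi : {unit 'Z_n} -> R[i]) : Prop :=
  [/\ (0 < d)%N, (d %| n)%N, factors_modulo d chi
    & forall e : nat, (0 < e)%N -> (e %| n)%N -> factors_modulo e chi ->
        (d <= e)%N].

Definition sigma (k m : nat) : nat := (\sum_(e <- divisors m) e ^ k)%N.

(* The variable [a1] is the difference a - 1 taken in 'Z_n; the gcd is that of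
   the canonical representatives. *)
Definition gcd_term (n k : nat) (a : {unit 'Z_n}) (b : {ffun 'I_k -> 'Z_n}) :
    nat :=
  let a1 : 'Z_n := (val a - 1)%R in
  gcdn a1 (gcdn (\big[gcdn/0%N]_(i < k) (b i : nat)) n).

(* Main.v *)
Require Import Defs.
From HB Require Import structures.
From mathcomp Require Import all_boot all_order all_algebra all_fingroup.
From mathcomp Require Import reals.
From mathcomp.real_closed Require Import complex.
From mathcomp Require Import cyclic.

(** This Menon-type identity comes from expanding the gcd by Gauss's formula
    [m = \sum_(e %| m) totient e]: the gcd of [a - 1], the [b i] and [n] is the
    sum of [totient e] over the divisors [e] of [n] that divide [a - 1] and
    every [b i] ([gcd_term_sum_totient]).  After exchanging the sums, the
    summation over [a] and the one over [b] separate for each [e].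

    The tuples [b] of multiples of [e] number [(n / e) ^ k].  The units [a]
    congruent to 1 modulo [e] form the kernel of the reduction modulo [e],
    which is onto, so there are [totient n / totient e] of them; the sum of
    [chi] over this subgroup is its order if [chi] is trivial on it and 0
    otherwise.  Being trivial there amounts to factoring modulo [e]
    ([factors_moduloP]), hence to [e] being a multiple of the conductor [d]
    ([factors_modulo_conductor]).  The factor [totient e] cancels and what
    remains is [totient n] times the sum of [(n / e) ^ k] over [d %| e %| n],
    in which [n / e] runs over the divisors of [n / d] ([sigma_div]).

    The conductor was defined as the least modulus through which [chi] factors;
    that it divides all the others holds because these moduli are closed under
    gcd ([factors_modulo_gcd]), which is the Chinese remainder theorem for
    moduli that need not be coprime ([residue_glue]). *)

Import GRing.Theory.
Local Open Scope ring_scope.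

(** * Divisor sums *)

Lemma sum_totient_divisors (m : nat) :
  (0 < m)%N -> (\sum_(e <- divisors m) totient e)%N = m.
Proof.
move=> m0; rewrite -[RHS]sum_totient_dvd.
rewrite -(big_mkord (fun d => d %| m)%N totient) -[RHS]big_filter.
apply: perm_big; apply: uniq_perm => [||e].
- exact: divisors_uniq.
- by rewrite filter_uniq ?iota_uniq.
rewrite -dvdn_divisors // mem_filter mem_index_iota ltnS /=.
by case: (boolP (e %| m)%N) => // /dvdn_leq->.
Qed.

(** Gauss's formula for [gcdn m n], whose divisors are the common divisors. *)
Lemma gcdn_sum_totient (m n : nat) : (0 < n)%N ->
  gcdn m n = (\sum_(e <- divisors n | (e %| m)%N) totient e)%N.
Proof.
move=> n0; have g0 : (0 < gcdn m n)%N by rewrite gcdn_gt0 n0 orbT.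
rewrite -{1}(sum_totient_divisors _ g0) -[RHS]big_filter.
apply: perm_big; apply: uniq_perm => [||e].
- exact: divisors_uniq.
- by rewrite filter_uniq ?divisors_uniq.
by rewrite mem_filter -!dvdn_divisors // dvdn_gcd.
Qed.

(** The map [e |-> n / e] exchanges the divisors of [n] that are multiples of
    [d] with the divisors of [n / d]. *)
Lemma sigma_div (k n d : nat) : (0 < n)%N -> (d %| n)%N ->
  (\sum_(e <- divisors n | (d %| e)%N) (n %/ e) ^ k)%N = sigma k (n %/ d).
Proof.
move=> n0 dn; have d0 : (0 < d)%N by exact: dvdn_gt0 dn.
have nd0 : (0 < n %/ d)%N by rewrite divn_gt0 // dvdn_leq.
rewrite -big_filter -(big_map (fun e => n %/ e)%N predT (fun f => f ^ k)%N).
have divK e : (e %| n)%N -> (n %/ (n %/ e))%N = e.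
  by move=> en; rewrite -{1}(divnK en) mulKn // divn_gt0 ?(dvdn_gt0 n0 en) //
             dvdn_leq.
apply: perm_big; apply: uniq_perm => [||f].
- rewrite map_inj_in_uniq ?filter_uniq ?divisors_uniq // => e1 e2.
  rewrite !mem_filter -!dvdn_divisors // => /andP[_ e1n] /andP[_ e2n] h.
  by rewrite -(divK _ e1n) h divK.
- exact: divisors_uniq.
rewrite -dvdn_divisors //; apply/mapP/idP => [[e]|fnd].
  rewrite mem_filter -dvdn_divisors // => /andP[de en] ->.
  by rewrite dvdn_divRL // -{2}(divnK en) dvdn_mul.
have fn : (f %| n)%N by apply: dvdn_trans fnd (dvdn_div dn).
exists (n %/ f)%N; last by rewrite divK.
rewrite mem_filter -dvdn_divisors // dvdn_div // andbT.
by move: fnd; rewrite !dvdn_divRL // mulnC.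
Qed.

(** * Unit residues and their reduction *)

(** The ring ['Z_1] is Z/2Z, so arithmetic in it says nothing about integers
    modulo 1.  Comparing natural representatives modulo a divisor of [n] is
    meaningful for every positive [n]: for [n = 1] that divisor is 1 and every
    congruence holds. *)
Definition residue (n : nat) (a : {unit 'Z_n}) : nat := val a.

Lemma val_Zp_mod (n : nat) (x : 'Z_n) : (1 < n)%N -> (x %% n)%N = x.
Proof. by move=> n1; rewrite modn_small // -[ltnRHS]Zp_cast. Qed.

Lemma residueM (n e : nat) (a b : {unit 'Z_n}) :
  (0 < n)%N -> (e %| n)%N ->
  residue n (a * b)%g = (residue n a * residue n b)%N %[mod e].
Proof.
case: n a b => [|[|n]] a b // _; first by
  rewrite dvdn1 => /eqP->; rewrite !modn1.
by move=> en; rewrite /residue /= modn_dvdm.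
Qed.

Lemma residue1 (n : nat) : residue n 1%g = 1%N.
Proof. by []. Qed.

Lemma residue_inj (n : nat) (a b : {unit 'Z_n}) :
  (0 < n)%N -> residue n a = residue n b %[mod n] -> a = b.
Proof.
case: n a b => [|[|n]] a b // _ => [_|].
  have /card_le1_eqP u1 : (#|units_Zp 1| <= 1)%N by rewrite card_units_Zp.
  by apply: u1; rewrite inE.
by rewrite /residue !val_Zp_mod // => /val_inj/val_inj.
Qed.

Lemma coprime_residue (n : nat) (a : {unit 'Z_n}) :
  (0 < n)%N -> coprime n (residue n a).
Proof.
case: n a => [|[|n]] a // _; first exact: coprime1n.
by rewrite -unitZpE // natr_Zp; apply: (valP a).
Qed.

Lemma residue_onto (n x : nat) :
  (0 < n)%N -> coprime n x -> exists a : {unit 'Z_n}, residue n a = x %[mod n].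
Proof.
case: n => [|[|n]] // _; first by exists 1%g; rewrite !modn1.
rewrite -unitZpE // => ux; exists (FinRing.Unit ux).
by rewrite /residue /= Zp_nat /= modn_mod.
Qed.

(** Units modulo [e] lift to units modulo a multiple [n]: split [n] into the
    part [q] built from the primes of [e] and the coprime part [r], and take
    the class that is [x] modulo [q] and 1 modulo [r].  It is prime to [r]
    trivially, and to [q] because [q] has the same primes as [e]. *)
Lemma residue_lift (n e x : nat) :
  (0 < n)%N -> (e %| n)%N -> coprime e x ->
  exists a : {unit 'Z_n}, residue n a = x %[mod e].
Proof.
move=> n0 en cex.
have e0 : (0 < e)%N by exact: dvdn_gt0 en.
have [e1|e1] := eqVneq e 1%N; first by exists 1%g; rewrite e1 !modn1.
have x0 : (0 < x)%N.
  by case: posnP cex => // ->; rewrite /coprime gcdn0 (negPf e1).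
pose q := (n`_(\pi(e)))%N; pose r := (n`_(\pi(e)^'))%N.
have cqr : coprime q r by exact: coprime_partC.
pose y := chinese q r x 1.
have e_q : (e %| q)%N by rewrite -(part_pnat_id (pnat_pi e0)) partn_dvd.
have cqx : coprime q x.
  apply: (@pnat_coprime \pi(e)); first exact: part_pnat.
  by rewrite -coprime_pi'.
have cny : coprime n y.
  rewrite -(partnC \pi(e) n0) coprimeMl -/q -/r; apply/andP; split.
    by rewrite -coprime_modr (chinese_modl cqr) coprime_modr.
  by rewrite -coprime_modr (chinese_modr cqr) coprime_modr coprimen1.
have [a ay] := residue_onto n y n0 cny; exists a.
by rewrite -(modn_dvdm _ en) ay (modn_dvdm _ en) -(modn_dvdm _ e_q)
           (chinese_modl cqr) modn_dvdm.
Qed.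

Lemma residue_reduction (n e : nat) (a : {unit 'Z_n}) :
  (0 < n)%N -> (e %| n)%N -> residue e (reduction e a) = residue n a %[mod e].
Proof.
move=> n0 en; have: (0 < e)%N by exact: dvdn_gt0 en.
rewrite leq_eqVlt => /predU1P[<-|e1]; first by rewrite !modn1.
rewrite /residue /reduction insubdK; last first.
  by rewrite unfold_in /= unitZpE // (coprime_dvdl en) // coprime_residue.
by rewrite val_Zp_nat // modn_mod.
Qed.

Definition congr1_units (n e : nat) : {set {unit 'Z_n}} :=
  [set a | residue n a == 1%N %[mod e]].

Lemma reductionM (n e : nat) : (0 < n)%N -> (e %| n)%N ->
  {morph (@reduction n e) : a b / (a * b)%g}.
Proof.
move=> n0 en a b; have e0 : (0 < e)%N by exact: dvdn_gt0 en.
apply: residue_inj => //.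
rewrite residue_reduction // !residueM // -[RHS]modnMm.
by rewrite !residue_reduction // modnMm.
Qed.

Lemma reduction_onto (n e : nat) (c : {unit 'Z_e}) :
  (0 < n)%N -> (e %| n)%N -> exists a : {unit 'Z_n}, reduction e a = c.
Proof.
move=> n0 en; have e0 : (0 < e)%N by exact: dvdn_gt0 en.
have [a ac] := residue_lift n e _ n0 en (coprime_residue e c e0).
by exists a; apply: residue_inj; rewrite // residue_reduction.
Qed.

Lemma reduction_eq1 (n e : nat) (a : {unit 'Z_n}) :
  (0 < n)%N -> (e %| n)%N -> (reduction e a == 1%g) = (a \in congr1_units n e).
Proof.
move=> n0 en; have e0 : (0 < e)%N by exact: dvdn_gt0 en.
rewrite inE -residue_reduction //; apply/eqP/eqP => [->|]; first by [].
by rewrite -(residue1 e) => /residue_inj->.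
Qed.

(** [congr1_units n e] is the kernel of the surjective reduction morphism. *)
Lemma card_congr1_units (n e : nat) : (0 < n)%N -> (e %| n)%N ->
  (#|congr1_units n e| * totient e)%N = totient n.
Proof.
move=> n0 en; have e0 : (0 < e)%N by exact: dvdn_gt0 en.
pose f := Morphism (in2W (reductionM n e n0 en) : {in [set: {unit 'Z_n}] &, _}).
have kerf : ('ker f)%g = congr1_units n e.
  apply/setP => a; rewrite -reduction_eq1 // inE in_setT andTb.
  by rewrite 2!inE.
have imf : (f @* [set: {unit 'Z_n}])%g = units_Zp e.
  apply/setP => c; rewrite inE; have [a ac] := reduction_onto n e c n0 en.
  by rewrite -ac; apply: mem_morphim; rewrite inE.
rewrite -card_units_Zp // -imf -kerf -card_units_Zp //.
have := card_isog (first_isog f).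
rewrite card_quotient ?ker_norm // => <-.
by rewrite Lagrange // subsetT.
Qed.

(** Chinese remainder theorem with compatible residues: 1 modulo [d] and [a]
    modulo [e] agree modulo the gcd, so they come from a class modulo the lcm;
    that class is prime to [d] and to [e], hence to their lcm, and therefore
    lifts to a unit modulo [n]. *)
Lemma residue_glue (n d e : nat) (a : {unit 'Z_n}) :
  (0 < n)%N -> (d %| n)%N -> (e %| n)%N ->
  a \in congr1_units n (gcdn d e) ->
  exists b : {unit 'Z_n},
    residue n b = 1%N %[mod d] /\ residue n b = residue n a %[mod e].
Proof.
move=> n0 dn en; rewrite inE => /eqP a1.
have d0 : (0 < d)%N by exact: dvdn_gt0 dn.
have e0 : (0 < e)%N by exact: dvdn_gt0 en.
(* [e] is added to the residue only to keep the subtraction of 1 in [nat]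
   faithful. *)
have [t at_] : exists t, (residue n a + e = 1 + gcdn d e * t)%N.
  have : (gcdn d e %| residue n a + e - 1)%N.
    rewrite -eqn_mod_dvd ?addn_gt0 ?e0 ?orbT //.
    by rewrite -modnDmr (eqP (dvdn_gcdr d e)) addn0 a1.
  case/dvdnP => t ht; exists t; rewrite mulnC -ht subnKC //.
  by rewrite addn_gt0 e0 orbT.
have [u v uv _] := egcdnP e d0.
(* By Bezout, [u * d = v * e + gcd], so adding [t * u * d] to 1 adds
   [t * gcd = a - 1] modulo [e] and nothing modulo [d]. *)
pose x := (1 + u * t * d)%N.
have xd : x = 1%N %[mod d] by rewrite /x addnC modnMDl.
have xe : x = residue n a %[mod e].
  have -> : x = (v * t * e + (residue n a + e))%N.
    by rewrite at_ /x mulnAC uv mulnDl mulnAC addnCA addnA.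
  by rewrite modnMDl modnDr.
have lcmdvd : (lcmn d e %| n)%N by rewrite dvdn_lcm dn en.
have cop : coprime (lcmn d e) x.
  apply: (@coprime_dvdl _ (d * e)%N).
    by rewrite dvdn_lcm dvdn_mulr ?dvdn_mull.
  rewrite coprimeMl -coprime_modr xd coprime_modr coprimen1 /=.
  rewrite -coprime_modr xe coprime_modr.
  by apply: coprime_dvdl en _; apply: coprime_residue.
have [b bx] := residue_lift n _ x n0 lcmdvd cop; exists b; split.
  by rewrite -(modn_dvdm _ (dvdn_lcml d e)) bx modn_dvdm ?dvdn_lcml.
by rewrite -(modn_dvdm _ (dvdn_lcmr d e)) bx modn_dvdm ?dvdn_lcmr.
Qed.

(** * Expansion of the gcd over common divisors *)

Lemma dvdn_subZp (n e : nat) (x y : 'Z_n) : (1 < n)%N -> (e %| n)%N ->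
  (e %| (x - y : 'Z_n)%R)%N = (x == y %[mod e])%N.
Proof.
case: n x y => [|[|n]] x y // _ en.
rewrite /dvdn /= modnDmr modn_dvdm // -(mod0n e) -[LHS](eqn_modDr y) add0n.
rewrite -addnA subnK ?(ltnW (ltn_ord y)) //.
by rewrite -modnDmr (eqP en) addn0.
Qed.

Lemma dvdn_unit_sub1 (n e : nat) (a : {unit 'Z_n}) : (0 < n)%N -> (e %| n)%N ->
  (e %| (val a - 1 : 'Z_n)%R)%N = (a \in congr1_units n e).
Proof.
case: n a => [|[|n]] a // _ en; last by rewrite dvdn_subZp // inE.
rewrite (residue_inj _ a 1%g) ?modn1 // [LHS]dvdn0 inE residue1.
by rewrite eqxx.
Qed.

(** The count of multiples in [1, n] is transported to the representatives
    [0, n - 1] by trading [n] for 0. *)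
Lemma card_multiples_Zp (n e : nat) : (0 < n)%N -> (e %| n)%N ->
  #|[set x in Zp n | (e %| x)%N]| = (n %/ e)%N.
Proof.
case: n => [|[|n]] // _ en.
  move: en; rewrite dvdn1 => /eqP->; rewrite -[RHS](card_Zp (isT : 0 < 1)%N).
  by apply: eq_card => x; rewrite inE dvd1n andbT.
rewrite divn_count_dvd big_add1 /= -sum1_card big_mkcond /=.
rewrite big_nat_recr //= en big_mkord [RHS]addnC [LHS]big_ord_recl.
congr (_ + _)%N; first by rewrite inE mem_Zp // dvdn0.
by apply: eq_bigr => i _; rewrite inE mem_Zp //; case: (_ %| _)%N.
Qed.

Lemma card_multiples_ffun (n k e : nat) : (0 < n)%N -> (e %| n)%N ->
  #|[set b : {ffun 'I_k -> 'Z_n} |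
      [forall i, b i \in Zp n] && [forall i, (e %| b i)%N]]| = ((n %/ e) ^ k)%N.
Proof.
move=> n0 en; rewrite -(card_multiples_Zp n e) //.
rewrite -[k in RHS]card_ord -card_ffun_on.
apply: eq_card => b; rewrite inE.
apply/andP/ffun_onP => [[/forallP bZ /forallP eb] i|bA].
  by rewrite inE bZ eb.
by split; apply/forallP => i; have:= bA i; rewrite inE => /andP[].
Qed.

Lemma gcd_term_sum_totient (n k : nat) (a : {unit 'Z_n})
    (b : {ffun 'I_k -> 'Z_n}) : (0 < n)%N ->
  gcd_term a b =
  (\sum_(e <- divisors n)
     totient e * ((a \in congr1_units n e) * [forall i, (e %| b i)%N]))%N.
Proof.
move=> n0; rewrite /gcd_term gcdnA gcdn_sum_totient // big_mkcond.
apply: eq_big_seq => e; rewrite -dvdn_divisors // => en.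
rewrite dvdn_gcd dvdn_unit_sub1 // mulnb.
have -> : (e %| \big[gcdn/0]_(i < k) b i)%N = [forall i, (e %| b i)%N].
  by apply/dvdn_biggcdP/forallP => eb i //; apply: eb.
by case: ifP; rewrite ?muln1 ?muln0.
Qed.

(** * Character sums over congruence subgroups *)

Lemma character1 {R : realType} {n : nat} (chi : {unit 'Z_n} -> R[i]) :
  dirichlet_character chi -> chi 1%g = 1.
Proof.
move=> [nz cM]; apply: (mulfI (nz 1%g)).
by rewrite -cM mulg1 mulr1.
Qed.

(** A character that is trivial on the kernel of reduction modulo [e] descends
    to a character modulo [e] because reduction is onto; the descended character
    is evaluated through an arbitrary choice of lifts. *)
Lemma factors_moduloP {R : realType} {n : nat} (chi : {unit 'Z_n} -> R[i])
    (e : nat) :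
  (0 < n)%N -> dirichlet_character chi -> (e %| n)%N ->
  factors_modulo e chi <-> {in congr1_units n e, forall a, chi a = 1}.
Proof.
move=> n0 chiP en; have [nz cM] := chiP; split=> [[psi [psiP chiE]] a|triv].
  rewrite -reduction_eq1 // chiE => /eqP->.
  rewrite -(character1 chi) // chiE; congr psi.
  by apply/esym/eqP; rewrite reduction_eq1 // inE residue1.
pose lift c := odflt 1%g [pick a : {unit 'Z_n} | reduction e a == c].
have liftK c : reduction e (lift c) = c.
  rewrite /lift; case: pickP => [a /eqP //|no].
  by have [a /eqP] := reduction_onto n e c n0 en; rewrite no.
have chi_red a b : reduction e a = reduction e b -> chi a = chi b.
  move=> ab; apply: (mulIf (nz b^-1%g)).
  rewrite -!cM mulgV (character1 chi chiP); apply: triv.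
  by rewrite -reduction_eq1 // reductionM // ab -reductionM // mulgV
             reduction_eq1 // inE residue1.
exists (fun c => chi (lift c)); split; first split=> // c1 c2.
  by rewrite -cM; apply: chi_red; rewrite reductionM // !liftK.
by move=> a; apply: chi_red; rewrite liftK.
Qed.

(** The kernel of reduction modulo the gcd is the product of the kernels modulo
    [d] and [e]: a unit [a] of it is [b * (b^-1 * a)] with [b] from
    [residue_glue], congruent to 1 modulo [d] and to [a] modulo [e]. *)
Lemma factors_modulo_gcd {R : realType} {n : nat} (chi : {unit 'Z_n} -> R[i])
    (d e : nat) :
  (0 < n)%N -> dirichlet_character chi -> (d %| n)%N -> (e %| n)%N ->
  factors_modulo d chi -> factors_modulo e chi -> factors_modulo (gcdn d e) chi.
Proof.
move=> n0 chiP dn en; have [nz cM] := chiP.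
move=> /(factors_moduloP chi d n0 chiP dn) trivd.
move=> /(factors_moduloP chi e n0 chiP en) trive.
have gn : (gcdn d e %| n)%N by apply: dvdn_trans dn; apply: dvdn_gcdl.
apply/factors_moduloP => // a aK.
have [b [bd be]] := residue_glue n d e a n0 dn en aK.
have e0 : (0 < e)%N by exact: dvdn_gt0 en.
have ba : reduction e b = reduction e a.
  by apply: residue_inj => //; rewrite !residue_reduction.
rewrite -[a](mulKVg b) cM trivd ?inE ?bd // mul1r trive //.
rewrite -reduction_eq1 // reductionM // -ba -reductionM // mulVg.
by rewrite reduction_eq1 // inE residue1.
Qed.

(** Orthogonality: translating the sum by an element [b] of the subgroup with
    [chi b != 1] multiplies it by [chi b] and leaves it unchanged. *)
Lemma sum_nontrivial_character {R : realType} {n : nat}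
    (chi : {unit 'Z_n} -> R[i]) (e : nat) :
  (0 < n)%N -> dirichlet_character chi -> (e %| n)%N ->
  ~ factors_modulo e chi -> \sum_(a in congr1_units n e) chi a = 0.
Proof.
move=> n0 chiP en nfac; have [nz cM] := chiP.
have [b bK b1] : exists2 b, b \in congr1_units n e & chi b != 1.
  apply/exists_inP; apply: contra_notT nfac => /exists_inPn triv.
  by apply/factors_moduloP => // a /triv; rewrite negbK => /eqP.
apply/eqP; set S := (X in X == 0).
have : chi b * S = S.
  rewrite {2}/S (reindex_inj (mulgI b)) /= mulr_sumr.
  apply: eq_big => [a|a _]; last by rewrite cM.
  move: bK; rewrite -!reduction_eq1 // reductionM // => /eqP->.
  by rewrite mul1g.
move/eqP; rewrite -subr_eq0 -{2}[S]mul1r -mulrBl mulf_eq0.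
by rewrite subr_eq0 (negPf b1).
Qed.

(** If [chi] factors modulo [e], it factors modulo [gcdn d e]; minimality of
    [d] forces this gcd to be [d]. *)
Lemma factors_modulo_conductor {R : realType} {n : nat}
    (chi : {unit 'Z_n} -> R[i]) (d e : nat) :
  (0 < n)%N -> dirichlet_character chi -> is_conductor d chi -> (e %| n)%N ->
  factors_modulo e chi <-> (d %| e)%N.
Proof.
move=> n0 chiP [d0 dn dfac dmin] en; split=> [efac|de].
  have gn : (gcdn d e %| n)%N by apply: dvdn_trans dn; apply: dvdn_gcdl.
  have gfac := factors_modulo_gcd chi d e n0 chiP dn en dfac efac.
  have dg := dmin _ (dvdn_gt0 n0 gn) gn gfac.
  apply/gcdn_idPl/eqP; rewrite eqn_leq dg andbT.
  by rewrite dvdn_leq ?dvdn_gcdl.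
apply/factors_moduloP => // a; rewrite inE => /eqP a1.
move/(factors_moduloP chi d n0 chiP dn): dfac; apply; rewrite inE.
by rewrite -(modn_dvdm _ de) a1 modn_dvdm.
Qed.

Lemma sum_character_conductor {R : realType} {n : nat}
    (chi : {unit 'Z_n} -> R[i]) (d e : nat) :
  (0 < n)%N -> dirichlet_character chi -> is_conductor d chi -> (e %| n)%N ->
  (totient e)%:R * (\sum_(a in congr1_units n e) chi a) =
  (totient n * (d %| e))%:R.
Proof.
move=> n0 chiP dP en.
have facE := factors_modulo_conductor chi d e n0 chiP dP en.
have [/facE/(factors_moduloP chi e n0 chiP en) triv|/negP nde] :=
  boolP (d %| e)%N.
  rewrite (eq_bigr (fun=> 1)) => [|a /triv //].
  by rewrite sumr_const -natrM mulnC card_congr1_units // muln1.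
by rewrite sum_nontrivial_character ?mulr0 ?muln0 // => /facE.
Qed.

(** * The Menon-type identity *)

Theorem theorem1p1 (R : realType) (n d k : nat) (chi : {unit 'Z_n} -> R[i]) :
  (0 < n)%N ->
  dirichlet_character chi ->
  is_conductor d chi ->
  \sum_(a in units_Zp n)
    \sum_(b : {ffun 'I_k -> 'Z_n} | [forall i, b i \in Zp n])
      (gcd_term a b)%:R * chi a
  = (totient n * sigma k (n %/ d))%:R.
Proof.
move=> n0 chiP dP; have [_ dn _ _] := dP.
pose B e (b : {ffun 'I_k -> 'Z_n}) := [forall i, (e %| b i)%N].
(* Each term is a product of a factor in [a] and a factor in [b], so that the
   two sums separate once the divisor [e] is fixed. *)
transitivity (\sum_(a in units_Zp n)
    \sum_(b : {ffun 'I_k -> 'Z_n} | [forall i, b i \in Zp n])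
    \sum_(e <- divisors n)
      ((totient e)%:R * ((a \in congr1_units n e)%:R * chi a)) * (B e b)%:R).
  apply: eq_bigr => a _; apply: eq_bigr => b _.
  rewrite gcd_term_sum_totient // natr_sum mulr_suml; apply: eq_bigr => e _.
  by rewrite !natrM -!mulrA [chi a * _]mulrC.
under eq_bigr => a _ do rewrite exchange_big.
rewrite exchange_big -(sigma_div _ _ _ n0 dn) big_distrr /= natr_sum.
rewrite [RHS]big_mkcond.
apply: eq_big_seq => e; rewrite -dvdn_divisors // => en.
have cardB : \sum_(b : {ffun 'I_k -> 'Z_n} | [forall i, b i \in Zp n])
    (B e b)%:R = ((n %/ e) ^ k)%:R :> R[i].
  rewrite -(card_multiples_ffun n k e n0 en) -sum1_card natr_sum.
  rewrite big_mkcond [RHS]big_mkcond; apply: eq_bigr => b _.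
  by rewrite inE /B; case: ifP => //= _; case: ifP.
under eq_bigr => a _ do rewrite -mulr_sumr cardB.
rewrite -mulr_suml -mulr_sumr.
have -> : \sum_(a in units_Zp n) (a \in congr1_units n e)%:R * chi a =
          \sum_(a in congr1_units n e) chi a.
  rewrite big_mkcond [RHS]big_mkcond; apply: eq_bigr => a _.
  by rewrite inE; case: ifP; rewrite ?mul1r ?mul0r.
rewrite (sum_character_conductor chi d e n0 chiP dP) // -natrM.
by case: ifP; rewrite ?muln1 ?muln0.
Qed.
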